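(* Let $N$ be a strict fuzzy negation, let $G$ be a grouping function, and let $\mathcal{GO}$ be the bivariate general overlap function defined by $\mathcal{GO}(x,y)=N(G(N(x),N(y)))$. Then $I_{G,N}=I_{\mathcal{GO}}^{N^{-1}}$, where $I_{G,N}(x,y)=G(N(x),y)$ and $I_{\mathcal{GO}}^{N^{-1}}(x,y)=N^{-1}(\mathcal{GO}(x,N^{-1}(y)))$ for all $x,y\in[0,1]$.
   Context: A fuzzy negation is a map $N:[0,1]\to[0,1]$ with $N(0)=1$, $N(1)=0$ and $N(x)\le N(y)$ whenever $y\le x$. It is strict if it is continuous and $N(x)<N(y)$ whenever $y<x$ (so $N$ is a bijection of $[0,1]$ with inverse $N^{-1}$). A grouping function is a function $G:[0,1]^2\to[0,1]$ that is commutative, continuous, increasing (in the non-strict sense) in each variable, and satisfies $G(x,y)=0$ if and only if $x=y=0$, and $G(x,y)=1$ if and only if $x=1$ or $y=1$. A bivariate general overlap function is a function $\mathcal{GO}:[0,1]^2\to[0,1]$ such that for all $x,y\in[0,1]$: (1) $\mathcal{GO}(x,y)=\mathcal{GO}(y,x)$; (2) if $xy=0$ then $\mathcal{GO}(x,y)=0$; (3) if $xy=1$ then $\mathcal{GO}(x,y)=1$; (4) $\mathcal{GO}$ is increasing (in the non-strict sense) in each variable; (5) $\mathcal{GO}$ is continuous. (The function $\mathcal{GO}$ in the claim is a bivariate general overlap function.) *)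

(* Defs.v *)
From HB Require Import structures.
From mathcomp Require Import all_boot all_order all_algebra.
From mathcomp Require Import all_classical all_reals all_analysis.
Set Implicit Arguments.
Unset Strict Implicit.
Unset Printing Implicit Defensive.
Import Order.TTheory GRing.Theory Num.Theory numFieldNormedType.Exports.
Local Open Scope classical_set_scope.
Local Open Scope ring_scope.

(* Elements of the unit interval are compared through \val.  The topology is the
   one that the library puts on set_type, i.e. the subspace topology;
   I01 R * I01 R then carries the product topology. *)
Definition I01 (R : realType) : Type := set_type `[(0 : R), (1 : R)]%classic.
HB.instance Definition _ (R : realType) := SubType.on (I01 R).
HB.instance Definition _ (R : realType) := Topological.on (I01 R).

Lemma zero_in_I01 (R : realType) : (0 : R) \in `[(0 : R), (1 : R)]%classic.
Proof. by rewrite inE /= in_itv /= lexx ler01. Qed.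

Lemma one_in_I01 (R : realType) : (1 : R) \in `[(0 : R), (1 : R)]%classic.
Proof. by rewrite inE /= in_itv /= lexx ler01. Qed.

Definition I0 (R : realType) : I01 R := exist _ 0 (zero_in_I01 R).
Definition I1 (R : realType) : I01 R := exist _ 1 (one_in_I01 R).
Arguments I0 {R}.
Arguments I1 {R}.

Definition fuzzy_negation (R : realType) (N : I01 R -> I01 R) : Prop :=
  [/\ N I0 = I1, N I1 = I0
    & forall x y : I01 R, \val y <= \val x -> \val (N x) <= \val (N y)].

Definition strict_fuzzy_negation (R : realType) (N : I01 R -> I01 R) : Prop :=
  [/\ fuzzy_negation N, continuous N
    & forall x y : I01 R, \val y < \val x -> \val (N x) < \val (N y)].

Definition commutative2 (R : realType) (F : I01 R -> I01 R -> I01 R) : Prop :=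
  forall x y, F x y = F y x.

Definition increasing2 (R : realType) (F : I01 R -> I01 R -> I01 R) : Prop :=
  (forall x x' y : I01 R, \val x <= \val x' -> \val (F x y) <= \val (F x' y)) /\
  (forall x y y' : I01 R, \val y <= \val y' -> \val (F x y) <= \val (F x y')).

(* Joint continuity on the square. *)
Definition continuous2 (R : realType) (F : I01 R -> I01 R -> I01 R) : Prop :=
  continuous (fun p : I01 R * I01 R => F p.1 p.2).

Definition grouping_function (R : realType)
    (G : I01 R -> I01 R -> I01 R) : Prop :=
  [/\ commutative2 G, continuous2 G, increasing2 G,
      forall x y, G x y = I0 <-> x = I0 /\ y = I0
    & forall x y, G x y = I1 <-> x = I1 \/ y = I1].

Definition general_overlap_function (R : realType)
    (GO : I01 R -> I01 R -> I01 R) : Prop :=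
  [/\ commutative2 GO,
      forall x y : I01 R, \val x * \val y = 0 -> GO x y = I0,
      forall x y : I01 R, \val x * \val y = 1 -> GO x y = I1,
      increasing2 GO
    & continuous2 GO].

(* The inverse of N on its range.  It is the two-sided inverse whenever N is a
   bijection of [0, 1]; the default value id is only used off the range. *)
Definition negation_inverse (R : realType) (N : I01 R -> I01 R) :
    I01 R -> I01 R := 'pinv_id setT N.

Definition GN_implication (R : realType) (G : I01 R -> I01 R -> I01 R)
    (N : I01 R -> I01 R) : I01 R -> I01 R -> I01 R :=
  fun x y => G (N x) y.

Definition GO_implication (R : realType) (GO : I01 R -> I01 R -> I01 R)
    (M : I01 R -> I01 R) : I01 R -> I01 R -> I01 R :=
  fun x y => M (GO x (M y)).

(* Main.v *)
Require Import Defs.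
From mathcomp Require Import all_boot all_order all_algebra.
From mathcomp Require Import all_classical all_reals all_analysis.
Import Order.TTheory GRing.Theory Num.Theory numFieldNormedType.Exports.
Local Open Scope classical_set_scope.
Local Open Scope ring_scope.

(** The function [GO] is the [N]-dual of [G], so the overlap axioms are the
    grouping axioms read through [N], which reverses the order and exchanges
    [0] and [1]: a product in [0, 1] vanishes when a factor is [0], which [N]
    sends to the annihilator [1] of [G], and it equals [1] only when both
    factors are [1], which [N] sends to [0], and [G 0 0 = 0].

    For the identity between the implications, write [M] for the inverse of
    [N]; then [M (GO x (M y)) = M (N (G (N x) (N (M y))))], and both cancellation
    laws between [M] and [N] reduce this to [G (N x) y].  The identity thus
    rests on [N] being a bijection.  Injectivity ([strict_negation_inj]) is strict
    monotonicity; surjectivity ([strict_negation_surj]) is the intermediate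
    value theorem, which applies to functions on the line and is therefore used
    on the extension of [N] by constants outside of [0, 1]. *)

Lemma I01_ge0 (R : realType) (x : I01 R) : 0 <= \val x.
Proof. by case: x => x /=; rewrite inE /= in_itv /= => /andP[]. Qed.

Lemma I01_le1 (R : realType) (x : I01 R) : \val x <= 1.
Proof. by case: x => x /=; rewrite inE /= in_itv /= => /andP[]. Qed.

Lemma clamp_subproof (R : realType) (t : R) :
  Num.max 0 (Num.min 1 t) \in `[(0 : R), (1 : R)]%classic.
Proof.
by rewrite inE /= in_itv /= le_max lexx /= ge_max ler01 /= ge_min lexx.
Qed.

(** The retraction of the line onto [0, 1]: composing with it extends a function
    on [0, 1] to the line without losing continuity. *)
Definition clamp (R : realType) (t : R) : I01 R :=
  exist _ (Num.max 0 (Num.min 1 t)) (clamp_subproof R t).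

Lemma clampK (R : realType) (x : I01 R) : clamp R (\val x) = x.
Proof.
by apply: val_inj; rewrite /= (min_idPr (I01_le1 _ x)) (max_idPr (I01_ge0 _ x)).
Qed.

Lemma continuous_clamp (R : realType) : continuous (clamp R).
Proof.
apply: (@continuous_comp_initial _ _ _ (set_val : _ -> R)) => t.
apply: (@continuous_max R R (fun=> 0) (fun t => Num.min 1 t)).
  exact: cst_continuous.
apply: (@continuous_min R R (fun=> 1) id); first exact: cst_continuous.
exact: cvg_id.
Qed.

Lemma continuous_I01_val (R : realType) :
  continuous (\val : I01 R -> R).
Proof. exact: (@initial_continuous _ _ (set_val : _ -> R)). Qed.

Lemma strict_negation_inj (R : realType) (N : I01 R -> I01 R) :
  strict_fuzzy_negation N -> injective N.
Proof.
move=> [_ _ Nlt] x y Nxy; apply: val_inj.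
by case: (ltgtP (\val x) (\val y)) => // /Nlt; rewrite Nxy ltxx.
Qed.

Lemma strict_negation_surj (R : realType) (N : I01 R -> I01 R) :
  strict_fuzzy_negation N -> forall y, exists x, N x = y.
Proof.
move=> [[N0 N1 _] Nc _] y.
pose f : R -> R := fun t => \val (N (clamp R t)).
have fc : continuous f.
  move=> t; apply: (@continuous_comp _ _ _ (N \o clamp R) \val).
    apply: continuous_comp; [exact: continuous_clamp | exact: Nc].
  exact: continuous_I01_val.
have f0 : f 0 = 1 by rewrite /f -[0]/(\val (@I0 R)) clampK N0.
have f1 : f 1 = 0 by rewrite /f -[X in clamp R X]/(\val (@I1 R)) clampK N1.
have [|c _ fcy] := IVT ler01 (continuous_subspaceT fc) (v := \val y).
  by rewrite f0 f1 min_r ?max_l ?ler01 // I01_ge0 I01_le1.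
by exists (clamp R c); apply: val_inj.
Qed.

Lemma negation_inverseKV (R : realType) (N : I01 R -> I01 R) :
  strict_fuzzy_negation N -> cancel N (negation_inverse N).
Proof.
move=> hN x; apply: pinvKV; last by rewrite inE.
by move=> u v _ _; apply: strict_negation_inj.
Qed.

Lemma negation_inverseK (R : realType) (N : I01 R -> I01 R) :
  strict_fuzzy_negation N -> cancel (negation_inverse N) N.
Proof.
move=> hN y; apply: pinvK; rewrite inE.
by have [x <-] := strict_negation_surj _ _ hN y; exists x.
Qed.

(** [N] acts once on the arguments and once on the value, so its two order
    reversals cancel and monotonicity is kept; on the endpoints the conjunctive
    behaviour required of an overlap function is the De Morgan dual of the
    disjunctive behaviour of [G]. *)
Lemma dual_grouping_overlap (R : realType) (N : I01 R -> I01 R)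
    (G : I01 R -> I01 R -> I01 R) :
  fuzzy_negation N -> continuous N -> grouping_function G ->
  general_overlap_function (fun x y => N (G (N x) (N y))).
Proof.
move=> [N0 N1 Nle] Nc [Gcomm Gc [Gl Gr] G0 G1]; split.
- by move=> x y; rewrite Gcomm.
- move=> x y /eqP; rewrite mulf_eq0 => xy0.
  suff /G1 -> : N x = I1 \/ N y = I1 by [].
  by case/orP: xy0 => /eqP u0; [left|right]; rewrite -N0; congr N; apply: val_inj.
- move=> x y xy1.
  (* In [0, 1] each factor bounds the product from above. *)
  have x1 : x = I1.
    apply/val_inj/le_anti; rewrite I01_le1 /= -[X in X <= _]xy1.
    by rewrite ler_piMr ?I01_ge0 ?I01_le1.
  have y1 : y = I1.
    apply/val_inj/le_anti; rewrite I01_le1 /= -[X in X <= _]xy1.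
    by rewrite ler_piMl ?I01_ge0 ?I01_le1.
  by rewrite x1 y1 N1; have /G0 -> : @I0 R = I0 /\ @I0 R = I0 by [].
- by split=> x y z h; apply: (Nle _ _); [apply: Gl | apply: Gr]; exact: Nle.
- move=> p.
  apply: (@continuous_comp _ _ _
    (fun q : I01 R * I01 R => G (N q.1) (N q.2)) N); last exact: Nc.
  apply: (@continuous_comp _ _ _ (fun q : I01 R * I01 R => (N q.1, N q.2))
    (fun q => G q.1 q.2)); last exact: Gc.
  apply: (cvg_pair (G := nbhs (N p.1)) (H := nbhs (N p.2))).
    by apply: (@continuous_comp _ _ _ fst N); [exact: cvg_fst | exact: Nc].
  by apply: (@continuous_comp _ _ _ snd N); [exact: cvg_snd | exact: Nc].
Qed.

Theorem proposition21 (R : realType) (N : I01 R -> I01 R)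
    (G : I01 R -> I01 R -> I01 R)
    (hN : strict_fuzzy_negation N) (hG : grouping_function G) :
  let GO : I01 R -> I01 R -> I01 R := fun x y => N (G (N x) (N y)) in
  general_overlap_function GO /\
  GN_implication G N = GO_implication GO (negation_inverse N).
Proof.
split; first by case: (hN) => Nneg Nc _; exact: (dual_grouping_overlap _ _ _ Nneg Nc hG).
apply/funext => x; apply/funext => y.
by rewrite /GN_implication /GO_implication negation_inverseK // negation_inverseKV.
Qed.
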